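(* Let $n\ge 2$. The pairing $V$ of cells of the bi-cyclopermutohedron $\mathrm{QP}_{n+1}$ described in the context is a discrete Morse function (i.e. a discrete vector field without closed $V$-paths).
   Context: Write $[n+1]=\{1,\dots,n+1\}$. A cyclically ordered partition of $[n+1]$ is an equivalence class of ordered partitions $(I_1,\dots,I_k)$ of $[n+1]$ into nonempty blocks under cyclic permutation of the blocks; it is always written with the block containing $n+1$ (the ''$n+1$-set'') last. The cyclopermutohedron $\mathrm{CP}_{n+1}$ is the regular CW complex of dimension $n-2$ whose $m$-cells, $0\le m\le n-2$, are labeled by the cyclically ordered partitions into $n-m+1$ blocks (so at least 3 blocks); a closed cell contains a cell iff the label of the latter refines that of the former preserving the cyclic order. The fixed-point-free involution $r(I_1,\dots,I_{k-1},I_k)=(I_{k-1},\dots,I_1,I_k)$ (with $n+1\in I_k$) acts on $\mathrm{CP}_{n+1}$, and $\mathrm{QP}_{n+1}=\mathrm{CP}_{n+1}/\langle r\rangle$ is a regular CW complex, with quotient map $\pi$; write $\bar\lambda=\pi(\lambda)$. Class: for a cell $\lambda=(I_1,\dots,I_k)$ of $\mathrm{CP}_{n+1}$ (with $n+1\in I_k$), let $j$ be the greatest element outside $I_k$, $j\in I_l$, and let $i$ be the greatest element outside $I_k\cup I_l$, $i\in I_m$. The class is $\mathrm{cl}(\lambda)=(i,j)$ if $m\le l$ and $(j,i)$ otherwise. A cell of class $(a,b)$ is ascending if $a<b$ and descending otherwise. Each cell of $\mathrm{QP}_{n+1}$ has exactly one ascending representative. The pairing: for $k=1,2,\dots,n-2$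 successively (Step $k$), pair two cells $\alpha=(\dots,\{k\},I,\dots)$ and $\beta=(\dots,\{k\}\cup I,\dots)$ of $\mathrm{CP}_{n+1}$ ($\beta$ being obtained by merging the singleton block $\{k\}$ with the block $I$ immediately following it) if (1) $n+1\notin I$; (2) $\alpha$ and $\beta$ were not paired at an earlier step; (3) $\alpha$ is ascending; (4) $\mathrm{cl}(\alpha)=\mathrm{cl}(\beta)$. Finally, $V$ consists of the pairs $(\bar\alpha,\bar\beta)$ for all pairs $(\alpha,\beta)$ so obtained. A discrete vector field on a regular CW complex is a collection $V$ of pairs $(\sigma^p,\tau^{p+1})$ of cells with $\sigma\subset\overline\tau$ such that each cell is in at most one pair. A $V$-path is a sequence $\sigma_1^p,\tau_1^{p+1},\dots,\sigma_t^p,\tau_t^{p+1},\sigma_{t+1}^p$ with $t\ge 1$, $(\sigma_i,\tau_i)\in V$, $\sigma_{i+1}\subset\overline{\tau_i}$ and $\sigma_{i+1}\ne\sigma_i$ for all $1\le i\le t$; it is closed if $\sigma_1=\sigma_{t+1}$. *)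

(* Defs.v *)
From HB Require Import structures.
From mathcomp Require Import all_boot.
Set Implicit Arguments.
Unset Strict Implicit.
Unset Printing Implicit Defensive.

(* Discrete vector fields.  They see a regular CW complex only through its
   cells [C], their dimensions, and the relation [incl s t]: the cell s is
   contained in the closure of the cell t. *)
Section DiscreteMorse.

Variables (C : Type) (dim : C -> nat) (incl : C -> C -> Prop).

Definition discrete_vector_field (V : C -> C -> Prop) : Prop :=
  (forall s t, V s t -> dim t = (dim s).+1 /\ incl s t) /\
  (forall s t s' t', V s t -> V s' t' ->
     [\/ s = s', s = t', t = s' | t = t'] -> s = s' /\ t = t').

(* The V-path sigma 0, tau 0, ..., sigma t.-1, tau t.-1, sigma t (indices are
   shifted down by one); only these values of sigma and tau matter. *)
Definition V_path (V : C -> C -> Prop) (p t : nat) (sigma tau : nat -> C) :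
    Prop :=
  [/\ 1 <= t,
      forall i, i <= t -> dim (sigma i) = p,
      forall i, i < t -> dim (tau i) = p.+1 &
      forall i, i < t ->
        [/\ V (sigma i) (tau i), incl (sigma i.+1) (tau i)
          & sigma i.+1 <> sigma i]].

Definition discrete_morse_function (V : C -> C -> Prop) : Prop :=
  discrete_vector_field V /\
  (forall p t sigma tau, V_path V p t sigma tau -> sigma 0 <> sigma t).

End DiscreteMorse.

Section BiCyclopermutohedron.

Variable n : nat.

(* x : 'I_n.+1 stands for the element x.+1 of [n+1] = {1, ..., n+1}; in
   particular ord_max stands for n+1. *)
Notation block := {set 'I_n.+1}.

Definition ordered_partition (s : seq block) : bool :=
  uniq s && partition [set B in s] [set: 'I_n.+1].

(* A cyclically ordered partition is represented by its unique rotation whose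
   last block contains n+1; the cells are those with at least 3 blocks. *)
Definition is_cell (s : seq block) : bool :=
  [&& ordered_partition s, ord_max \in last set0 s & 3 <= size s].

Record CP : Type := Cell { blocks :> seq block; cellP : is_cell blocks }.

HB.instance Definition _ := [isSub for blocks].
HB.instance Definition _ := [Choice of CP by <:].

Definition CP_dim (c : CP) : nat := n.+1 - size c.

(* The label of c refines that of d preserving the cyclic order: some rotation
   of c can be cut into consecutive runs whose unions are the blocks of d. *)
Definition CP_incl (c d : CP) : Prop :=
  exists (j : nat) (ss : seq (seq block)),
    flatten ss = rot j c /\
    blocks d = [seq \bigcup_(B <- s) B | s <- ss].

(* (I_1, ..., I_k) |-> (I_(k-1), ..., I_1, I_k) *)
Definition r_seq (s : seq block) : seq block := rot 1 (rev s).

Lemma r_seqK : involutive r_seq.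
Proof. by move=> s; rewrite /r_seq rev_rot revK rotrK. Qed.

Lemma is_cell_r s : is_cell s -> is_cell (r_seq s).
Proof.
case/and3P=> /andP[us ps] ls ss.
apply/and3P; split; last by rewrite size_rot size_rev.
- rewrite /ordered_partition rot_uniq rev_uniq us /=.
  suff -> : [set B in r_seq s] = [set B in s] by [].
  by apply/setP=> B; rewrite !inE mem_rot mem_rev.
- case/lastP: s ls {us ps ss} => [|s x]; first by rewrite inE.
  by rewrite /r_seq rev_rcons rot1_cons !last_rcons.
Qed.

Definition r (c : CP) : CP := Cell (is_cell_r (cellP c)).

Lemma rK : involutive r.
Proof. by move=> c; apply/val_inj/r_seqK. Qed.

Definition r_eq (c d : CP) : bool := (c == d) || (r c == d).

Lemma r_eq_refl : reflexive r_eq.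
Proof. by move=> c; rewrite /r_eq eqxx. Qed.

Lemma r_eq_sym : symmetric r_eq.
Proof.
move=> c d; rewrite /r_eq eq_sym; congr (_ || _).
by apply/eqP/eqP => <-; rewrite rK.
Qed.

Lemma r_eq_trans : transitive r_eq.
Proof.
move=> d c e /orP[] /eqP <- // /orP[] /eqP <-; rewrite /r_eq.
  by rewrite eqxx orbT.
by rewrite rK eqxx.
Qed.

Canonical r_equiv := EquivRel r_eq r_eq_refl r_eq_sym r_eq_trans.

Local Open Scope quotient_scope.

Definition QP : Type := {eq_quot r_equiv}.

HB.instance Definition _ := Choice.on QP.
HB.instance Definition _ := EqQuotient.on QP.

Definition bar (c : CP) : QP := \pi_QP c.

Lemma bar_eq c d : (bar c == bar d) = (c == d) || (r c == d).
Proof. by rewrite /bar eqquotE. Qed.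

Definition QP_dim (x : QP) : nat := CP_dim (repr x).

Lemma QP_dim_bar c : QP_dim (bar c) = CP_dim c.
Proof.
have : bar (repr (bar c)) == bar c by rewrite /bar reprK.
rewrite bar_eq /QP_dim; case/orP=> /eqP; first by move->.
by move: (repr _) => d <-; rewrite /CP_dim /= size_rot size_rev.
Qed.

Definition QP_incl (x y : QP) : Prop :=
  exists c d : CP, [/\ bar c = x, bar d = y & CP_incl c d].

(* Junk value for A = set0. *)
Definition greatest (A : block) : 'I_n.+1 := [arg max_(x > ord0 in A) x].

Lemma greatestP (A : block) (x : 'I_n.+1) :
  x \in A -> greatest A \in A /\ x <= greatest A.
Proof.
move=> Ax; rewrite /greatest /arg_max /extremum.
case: pickP => [y /andP[Ay /forall_inP]|no]; first by move/(_ x Ax).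
have [y Ay My] := @arg_maxnP _ x (mem A) (@nat_of_ord _) Ax.
by case/andP: (no y); split=> //; apply/forall_inP.
Qed.

Definition block_index (s : seq block) (x : 'I_n.+1) : nat :=
  find (fun B : block => x \in B) s.

Definition cl (c : CP) : 'I_n.+1 * 'I_n.+1 :=
  let Ik := last set0 c in
  let j := greatest (~: Ik) in
  let l := block_index c j in
  let i := greatest (~: (Ik :|: nth set0 c l)) in
  let m := block_index c i in
  if m <= l then (i, j) else (j, i).

Definition ascending (c : CP) : Prop := (cl c).1 < (cl c).2.

(* alpha and beta are paired at Step x.+1 (whose singleton is {x.+1}), where
   [earlier] is the set of cells paired at the earlier steps.  The block {x}
   is never the last one when n+1 is not in I, so the pattern does not wrap
   around. *)
Definition paired_at (x : 'I_n.+1) (earlier : CP -> Prop) (alpha beta : CP) :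
    Prop :=
  (exists (s t : seq block) (I : block),
     [/\ blocks alpha = s ++ [set x] :: I :: t,
         blocks beta = s ++ (x |: I) :: t
       & ord_max \notin I]) /\
  [/\ ~ earlier alpha, ~ earlier beta, ascending alpha & cl alpha = cl beta].

(* The cells paired at one of the Steps 1, ..., k. *)
Fixpoint paired_upto (k : nat) : CP -> Prop :=
  match k with
  | 0 => fun _ => False
  | k'.+1 => fun c =>
      paired_upto k' c \/
      exists (x : 'I_n.+1) (d : CP), x = k' :> nat /\
        (paired_at x (paired_upto k') c d \/ paired_at x (paired_upto k') d c)
  end.

Definition CP_pair (alpha beta : CP) : Prop :=
  exists x : 'I_n.+1, 1 <= x.+1 <= n - 2 /\
    paired_at x (paired_upto x) alpha beta.

Definition V (x y : QP) : Prop :=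
  exists alpha beta : CP,
    [/\ CP_pair alpha beta, x = bar alpha & y = bar beta].

End BiCyclopermutohedron.

(* Main.v *)
Require Import Defs.
From mathcomp Require Import all_boot.
From mathcomp Require Import zify.
Set Implicit Arguments.
Unset Strict Implicit.
Unset Printing Implicit Defensive.

(** Every cell of the quotient has exactly one ascending representative, and
both members of a pair are ascending, so the pairing lives on the ascending
cells of the cyclopermutohedron.  For a cell c with last block L, write j for
the greatest element outside L and i for the greatest element outside L and
outside the block of j; c is ascending when the block of i precedes that of j.

The inductive rule excluding cells paired earlier has a closed form.  Call x
free in c if cutting {x} out of its block does not alter the class.  If {x} is
a block other than L, then x is free automatically; it is stuck when it is not
merged forwards, either because the merge would put i and j together, or
because {x} starts a decreasing run of singletons ending right before L.  (In
such a run y > z > ... > w, merging {y} with {z} gives a cell that was already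
paired at step z or before.)  A free element that is not stuck is movable, and an ascending cell is paired by step x exactly when some
element up to x is movable (paired_uptoP); its own step is then its least
movable element (paired_at_movable).  The reason is that merging {y} with the
next block, when y is not stuck, does not affect which z < y are stuck
(stuck_split, stuck_merge).
Since the step is determined by the cell, and the partner by the cell and the
step, the pairing is a discrete vector field (V_vector_field).

Let alpha_0, beta_0, alpha_1, ... be the ascending representatives along a
closed path.  Merging preserves L, i and j, whereas passing to a face can only
shrink L, and cannot decrease i while L is constant.  So L, i and j are
constant along the path.  Hence L is never cut, alpha_(t+1) is obtained from
beta_t by cutting one block in two without any rotation or reversal, and the
set of free elements is constant.  Suppose that x is the smallest step that
occurs.  Every cell of the path whose step is greater has x free but not
movable, so {x} is one of its blocks.  A pair of step x goes from
(..., {x}, I, ...) to (..., {x} u I, ...), and the next cell must again have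
{x} as a block while differing from the first: it is (..., I, {x}, ...).  The
set of elements to the right of x and outside L has lost I (right_of_swap).
All other moves leave that set unchanged (right_of_split), so the path cannot
close up (V_acyclic). *)

(** * Cells seen through the position of each element *)

Lemma count1_nth (T : Type) (a : pred T) (x0 : T) (s : seq T) (k : nat) :
  count a s = 1 -> k < size s -> a (nth x0 s k) = (find a s == k).
Proof.
elim: s k => //= B s IH [|k] /=; first by case: (a B).
case: ifP => aB /=; last by move=> cs; rewrite ltnS => /(IH _ cs) ->; rewrite eqSS.
move=> [] /eqP cs ks /=; apply: contraTF cs => ak; rewrite -lt0n -has_count.
by apply/(has_nthP x0); exists k.
Qed.

Section Proof.

Variable n : nat.
Notation block := {set 'I_n.+1}.
Implicit Types (c d : CP n) (s t : seq block) (A B I : block) (x y z w : 'I_n.+1).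
Local Notation idx := (@block_index n).
Local Notation lastb s := (last set0 s).

(** Counting the blocks that contain a given element makes cutting and merging
adjacent blocks a matter of arithmetic. *)
Lemma ordered_partitionP s :
  ordered_partition s <->
    set0 \notin s /\ forall x, count (fun B : block => x \in B) s = 1.
Proof.
split.
- case/andP=> us /and3P[/eqP cov /trivIsetP triv n0]; rewrite inE in n0.
  split=> // x; have: x \in cover [set B in s] by rewrite cov inE.
  case/bigcupP=> B; rewrite inE => Bs xB.
  rewrite -(_ : count_mem B s = 1); last by rewrite count_uniq_mem // Bs.
  apply: eq_in_count => D Ds /=; apply/idP/eqP=> [xD|->//].
  apply/eqP; apply: contraTT xD => DB.
  have := triv D B; rewrite !inE => /(_ Ds Bs DB) dj.
  by apply/negP=> xD; have := disjointFr dj xD; rewrite xB.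
- case=> n0 cnt.
  have two x A B : A \in s -> B \in s -> x \in A -> x \in B -> A = B.
    move=> As Bs xA xB; apply/eqP/negP=> /negP AB.
    have : count (predU (pred1 A) (pred1 B)) s <= count (fun B : block => x \in B) s.
      by apply: sub_count => D /= /orP[]/eqP->.
    rewrite cnt -(leq_add2r (count (predI (pred1 A) (pred1 B)) s)) count_predUI.
    rewrite (_ : count (predI _ _) s = 0); last first.
      rewrite (eq_count (a2 := pred0)) ?count_pred0 // => D /=.
      by apply/negP=> /andP[/eqP-> /eqP AB']; rewrite AB' eqxx in AB.
    by have := As; have := Bs; rewrite -!has_pred1 !has_count; lia.
  apply/andP; split.
    apply: count_mem_uniq => B.
    case: (boolP (B \in s)) => [Bs|/count_memPn//].
    have [x xB] : exists x, x \in B.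
      by apply/set0Pn; apply: contraNneq n0 => <-.
    rewrite [RHS]/=; apply/eqP; rewrite eqn_leq -has_count has_pred1 Bs andbT -(cnt x).
    by apply: sub_count => D /= /eqP->.
  apply/and3P; split; last by rewrite inE.
  + apply/eqP/setP=> x; rewrite inE; apply/bigcupP.
    have : has (fun B : block => x \in B) s by rewrite has_count cnt.
    by case/hasP=> B Bs xB; exists B; rewrite ?inE.
  + apply/trivIsetP=> A B; rewrite !inE => As Bs AB.
    apply/pred0P=> x /=; apply/negP=> /andP[xA xB].
    by rewrite (two x A B) ?eqxx in AB.
Qed.

Lemma cell_count c x : count (fun B : block => x \in B) c = 1.
Proof. by case/and3P: (cellP c) => /ordered_partitionP[]. Qed.

Lemma cell_uniq c : uniq c.
Proof. by case/and3P: (cellP c) => /andP[]. Qed.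

Lemma cell_size c : 3 <= size c.
Proof. by case/and3P: (cellP c). Qed.

Lemma cell_last c : ord_max \in lastb c.
Proof. by case/and3P: (cellP c). Qed.

Lemma cell_neq0 c A : A \in blocks c -> exists x, x \in A.
Proof.
case/and3P: (cellP c) => /ordered_partitionP[n0 _] _ _ Ac.
by apply/set0Pn; apply: contraNneq n0 => <-.
Qed.

Lemma idx_lt c x : idx c x < size c.
Proof. by rewrite -has_find has_count cell_count. Qed.

Lemma mem_nth_cell c x k : k < size c -> (x \in nth set0 c k) = (idx c x == k).
Proof. exact: (count1_nth set0 (cell_count c x)). Qed.

Lemma mem_last_cell c x : (x \in lastb c) = (idx c x == (size c).-1).
Proof. by rewrite -nth_last mem_nth_cell //; have := cell_size c; lia. Qed.

Lemma notin_last c x : (x \notin lastb c) = (idx c x < (size c).-1).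
Proof. by rewrite mem_last_cell; have := idx_lt c x; lia. Qed.

Lemma idx_surj c k : k < size c -> exists x, idx c x = k.
Proof.
move=> kc; case: (cell_neq0 (mem_nth set0 kc)) => x.
by rewrite mem_nth_cell // => /eqP; exists x.
Qed.

Lemma idx_cat c s A t x : blocks c = s ++ A :: t ->
  (x \in A) = (idx c x == size s).
Proof.
move=> E; rewrite -mem_nth_cell E ?size_cat /=; last lia.
by rewrite nth_cat ltnn subnn.
Qed.

(** Makes the truncated subtraction in the dimension of a cell exact. *)
Lemma cell_size_le c : size c <= n.+1.
Proof.
case/and3P: (cellP c) => /andP[us pt] _ _.
have cp := card_partition pt; rewrite cardsT card_ord in cp.
apply: (@leq_trans (\sum_(B in [set B in blocks c]) #|B|)); last by rewrite -cp.
rewrite -(card_uniqP us) -cardsE -sum1_card; apply: leq_sum => B.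
by rewrite inE => /cell_neq0 [x xB]; rewrite card_gt0; apply/set0Pn; exists x.
Qed.

(** * The class of a cell and the involution *)

Definition top1 c : 'I_n.+1 := greatest (~: lastb c).
Definition top2 c : 'I_n.+1 :=
  greatest (~: (lastb c :|: nth set0 c (idx c (top1 c)))).

Lemma top1P c : top1 c \notin lastb c /\ forall w, w \notin lastb c -> w <= top1 c.
Proof.
have [x x0] : exists x, idx c x = 0 by apply: idx_surj; have := cell_size c; lia.
have xL : x \in ~: lastb c.
  by rewrite inE notin_last x0; have := cell_size c; lia.
split; first by have [] := greatestP xL; rewrite inE.
by move=> w wL; have /greatestP[] : w \in ~: lastb c by rewrite inE.
Qed.

Lemma mem_top2_domain c w :
  (w \in ~: (lastb c :|: nth set0 c (idx c (top1 c)))) =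
  (w \notin lastb c) && (idx c w != idx c (top1 c)).
Proof. by rewrite !inE negb_or mem_nth_cell ?idx_lt. Qed.

Lemma top2P c : [/\ top2 c \notin lastb c, idx c (top2 c) <> idx c (top1 c) &
  forall w, w \notin lastb c -> idx c w <> idx c (top1 c) -> w <= top2 c].
Proof.
have [j1 _] := top1P c; rewrite notin_last in j1.
have sz := cell_size c.
have kc : (idx c (top1 c) == 0 : nat) < size c by lia.
have [x xk] := idx_surj kc.
have xD : x \in ~: (lastb c :|: nth set0 c (idx c (top1 c))).
  by rewrite mem_top2_domain notin_last; lia.
have [] := greatestP xD; rewrite mem_top2_domain -/(top2 c) => /andP[h1 /eqP h2] _.
split=> // w wL wj.
have wD : w \in ~: (lastb c :|: nth set0 c (idx c (top1 c))).
  by rewrite mem_top2_domain wL; apply/eqP.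
by have [] := greatestP wD.
Qed.

Lemma top2_uniq c i : i \notin lastb c -> idx c i <> idx c (top1 c) ->
  (forall w, w \notin lastb c -> idx c w <> idx c (top1 c) -> w <= i) ->
  i = top2 c.
Proof.
move=> iL ij ub; have [h1 h2 h3] := top2P c.
by apply/val_inj/eqP; rewrite /= eqn_leq h3 // ub.
Qed.

Lemma ascendingE c : ascending c <-> idx c (top2 c) < idx c (top1 c).
Proof.
rewrite /ascending /cl -/(top1 c) -/(top2 c).
have [h1 h2 h3] := top2P c; have [g1 g2] := top1P c.
have := g2 _ h1; have : top2 c <> top1 c :> nat by move/val_inj=> e; rewrite e in h2.
by case: (leqP (idx c (top2 c))) => /=; lia.
Qed.

Lemma cl_ascending c : ascending c -> cl c = (top2 c, top1 c).
Proof. by move/ascendingE/ltnW; rewrite /cl -/(top1 c) -/(top2 c) => ->. Qed.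

Lemma blocks_rcons c : blocks c = rcons (take (size c).-1 c) (lastb c).
Proof.
have := cell_size c; move: (blocks c); case/lastP=> [//|s A _].
by rewrite last_rcons size_rcons /= -{2}cats1 take_size_cat.
Qed.

Lemma blocks_r c : blocks (r c) = rcons (rev (take (size c).-1 c)) (lastb c).
Proof. by rewrite /= {1}blocks_rcons /r_seq rev_rcons rot1_cons. Qed.

Lemma last_r c : lastb (r c) = lastb c.
Proof. by rewrite blocks_r last_rcons. Qed.

Lemma size_r c : size (r c) = size c.
Proof. by rewrite /= size_rot size_rev. Qed.

Lemma idx_r c x : x \notin lastb c -> idx (r c) x = size c - (idx c x).+2.
Proof.
move=> xL; have xL' : x \notin lastb (r c) by rewrite last_r.
have sz := cell_size c.
move: xL xL'; rewrite !notin_last size_r => xL xL'.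
have : x \in nth set0 (blocks (r c)) (idx (r c) x) by rewrite mem_nth_cell ?idx_lt.
move: (idx (r c) x) xL' => k kc; have szt : size (take (size c).-1 c) = (size c).-1.
  by rewrite size_take ifT //; lia.
rewrite blocks_r nth_rcons size_rev szt kc nth_rev szt // nth_take; last lia.
by rewrite mem_nth_cell; lia.
Qed.

Lemma top1_r c : top1 (r c) = top1 c.
Proof. by rewrite /top1 last_r. Qed.

Lemma top2_r c : top2 (r c) = top2 c.
Proof.
have [h1 h2 h3] := top2P c; have [g1 g2] := top1P c.
symmetry; apply: top2_uniq; rewrite ?last_r ?top1_r // ?idx_r //.
- by move: h1 g1; rewrite !notin_last; lia.
- move=> w wL; rewrite !idx_r // => ne; apply: h3 => //.
  by move=> e; rewrite e in ne.
Qed.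

(** The two elements of the class are intrinsic and the involution exchanges
the order of their blocks. *)
Lemma ascending_r c : ascending (r c) <-> ~ ascending c.
Proof.
have [h1 h2 _] := top2P c; have [g1 _] := top1P c.
rewrite !ascendingE top1_r top2_r !idx_r //.
by move: h1 g1; rewrite !notin_last; lia.
Qed.

Definition asc_rep (u : QP n) : CP n :=
  if (cl (repr u)).1 < (cl (repr u)).2 then repr u else r (repr u).

Lemma asc_rep_bar c : ascending c -> asc_rep (bar c) = c.
Proof.
move=> asc; rewrite /asc_rep.
have : bar (repr (bar c)) == bar c by rewrite /bar generic_quotient.reprK.
rewrite bar_eq; move: (repr _) => d /orP[] /eqP E.
  by rewrite E ifT.
rewrite ifF //; apply/negbTE/negP => ascd; rewrite -E in asc.
by move/ascending_r: asc; apply.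
Qed.

Lemma bar_asc_inj c d : ascending c -> ascending d -> bar c = bar d -> c = d.
Proof. by move=> ac ad e; rewrite -(asc_rep_bar ac) e asc_rep_bar. Qed.

Lemma bar_r c : bar (r c) = bar c.
Proof. by apply/eqP; rewrite bar_eq rK eqxx orbT. Qed.


(** * Cutting one block in two *)

(** The last block is left alone, so that no rotation of the blocks can occur;
requiring t to be nonempty says just that. *)
Definition splits c d s A B t : Prop :=
  [/\ blocks c = s ++ A :: B :: t, blocks d = s ++ (A :|: B) :: t & 0 < size t].

(** The single arithmetic fact from which all comparisons of orders between a
cell and a face are derived. *)
Lemma idx_merge s A B t x (k := idx (s ++ A :: B :: t) x) :
  idx (s ++ (A :|: B) :: t) x = k - (size s < k).
Proof.
rewrite /k /block_index !find_cat /= inE.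
case: ifP => [|_]; first by rewrite has_find; lia.
by case: (x \in A); case: (x \in B) => /=; lia.
Qed.

Section Splits.

Variables (c d : CP n) (s : seq block) (A B : block) (t : seq block).
Hypothesis cd : splits c d s A B t.

Lemma split_idx x : idx d x = idx c x - (size s < idx c x).
Proof. by case: cd => -> -> _; rewrite idx_merge. Qed.

Lemma split_size : size c = (size d).+1.
Proof. by case: cd => -> -> _; rewrite !size_cat /=; lia. Qed.

Lemma split_last : lastb d = lastb c.
Proof. by case: cd => -> -> ; case: t => // T t' _; rewrite !last_cat. Qed.

Lemma split_top1 : top1 d = top1 c.
Proof. by rewrite /top1 split_last. Qed.

Lemma split_mem1 x : (x \in A) = (idx c x == size s).
Proof. by case: cd => e _ _; apply: idx_cat e. Qed.

Lemma split_mem2 x : (x \in B) = (idx c x == (size s).+1).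
Proof.
by case: cd; rewrite -cat_rcons => e _ _; rewrite (idx_cat _ e) size_rcons.
Qed.

Lemma split_pos : (size s).+2 < size c.
Proof. by case: cd => -> _; rewrite !size_cat /=; lia. Qed.

(** Cutting a block other than the last can only enlarge the set of which i is
the greatest element. *)
Lemma split_top2_le : top2 d <= top2 c.
Proof.
have [h1 h2 _] := top2P d; have [_ _ h3] := top2P c.
apply: h3; first by rewrite -split_last.
by move=> e; apply: h2; rewrite split_top1 !split_idx e.
Qed.

Lemma merge_top2 : idx d (top2 c) <> idx d (top1 c) -> top2 d = top2 c.
Proof.
move=> ne; have [h1 h2 h3] := top2P c.
symmetry; apply: top2_uniq; rewrite ?split_last ?split_top1 //.
by move=> w wL wne; apply: h3 => // e; apply: wne; rewrite !split_idx e.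
Qed.

Lemma merge_asc :
  ascending c -> idx d (top2 c) <> idx d (top1 c) -> ascending d.
Proof.
move=> /ascendingE ac ne; apply/ascendingE; rewrite merge_top2 // split_top1.
by move: ac ne; rewrite !split_idx; lia.
Qed.

Lemma split_top2 : (forall w, w \notin lastb c -> idx c w <> idx c (top1 c) -> w <= top2 d) ->
  top2 c = top2 d.
Proof.
move=> h; have [h1 h2 _] := top2P d.
symmetry; apply: top2_uniq; rewrite -?split_last // -?split_top1.
by move=> e; apply: h2; rewrite !split_idx e.
by rewrite split_top1 split_last.
Qed.

(** A strict inequality of positions survives cutting, since merging is
monotone. *)
Lemma split_asc : top2 c = top2 d -> ascending d -> ascending c.
Proof.
move=> e /ascendingE ad; apply/ascendingE.
by move: ad; rewrite -e split_top1 !split_idx; lia.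
Qed.

End Splits.

(** * Free, stuck and movable elements *)

(** The elements x that can be cut out of their block without changing the
class: an x distinct from j must not become a new candidate for i when it
leaves the block of j; and if j itself is cut out, the rest of its block must
not contain anything above i.  The condition depends on c only through its
last block and its class. *)
Definition free c x :=
  [&& x \notin lastb c, (x != top1 c) ==> (x <= top2 c) &
    (x == top1 c) ==>
      [forall w, (w \notin lastb c) ==> (w != top1 c) ==> (w <= top2 c)]].

Definition single c x := [forall w, (idx c w == idx c x) ==> (w == x)].

(** Says in terms of positions that the blocks from that of x up to the last
one, excluded, are singletons with decreasing elements. *)
Definition decr c x :=
  [forall w, forall w', (w \notin lastb c) ==> (w' \notin lastb c) ==>
     (idx c x <= idx c w <= idx c w') ==> (w' <= w)].

(** The singletons that do not serve as the lower cell of a pair: {i} right before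
the block of j, and the beginning of a decreasing run (see decr): just before the
last block no merge is possible, and farther left the merge already has a
partner. *)
Definition stuck c x :=
  single c x &&
  ((x == top2 c) && (idx c (top1 c) == (idx c x).+1) || decr c x).

Definition movable c x := free c x && ~~ stuck c x.

Lemma freeP c x : reflect [/\ x \notin lastb c, x <> top1 c -> x <= top2 c &
    x = top1 c -> forall w, w \notin lastb c -> w <> top1 c -> w <= top2 c]
  (free c x).
Proof.
apply: (iffP and3P) => -[h1 h2 h3]; split=> //.
- by move=> /eqP; move/implyP: h2; apply.
- move/eqP; move/implyP: h3 => h3 /h3/forallP h4 w wL /eqP wj.
  by move: (h4 w); rewrite wL wj.
- by apply/implyP => /eqP.
- apply/implyP=> /eqP/h3 h4; apply/forallP=> w.
  by apply/implyP=> wL; apply/implyP=> /eqP; apply: h4.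
Qed.

Lemma singleP c x : reflect (forall w, idx c w = idx c x -> w = x) (single c x).
Proof.
apply: (iffP forallP) => h w; first by move/eqP=> e; move: (h w); rewrite e => /eqP.
by apply/implyP=> /eqP/h/eqP.
Qed.

Lemma decrP c x : reflect (forall w w', w \notin lastb c -> w' \notin lastb c ->
    idx c x <= idx c w -> idx c w <= idx c w' -> w' <= w) (decr c x).
Proof.
apply: (iffP forallP) => [h w w' h1 h2 h3 h4|h w].
  by move/forallP/(_ w'): (h w); rewrite h1 h2 h3 h4.
apply/forallP=> w'; apply/implyP=> h1; apply/implyP=> h2; apply/implyP.
by case/andP; apply: h.
Qed.

Lemma decr_single c x : x \notin lastb c -> decr c x -> single c x.
Proof.
move=> xL /decrP h; apply/singleP=> w e; apply/val_inj/eqP.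
have wL : w \notin lastb c by rewrite notin_last e -notin_last.
by rewrite /= eqn_leq !h // e.
Qed.

(** If {x} is a block distinct from that of j, then x competes for i; if j
forms a block by itself, everything else outside L does. *)
Lemma single_free c x : x \notin lastb c -> single c x -> free c x.
Proof.
move=> xL /singleP sx; have [_ _ h3] := top2P c; apply/freeP; split=> //.
- by move=> xj; apply: h3 => // e; apply: xj; rewrite (sx _ (esym e)).
- by move=> xj w wL wj; apply: h3 => // e; apply: wj; rewrite -xj in e *; apply: sx.
Qed.

Lemma free_eq c d x : lastb c = lastb d -> top2 c = top2 d -> free c x = free d x.
Proof. by move=> eL e2; rewrite /free e2 /top1 eL. Qed.

Lemma movable_nsingle c x : free c x -> ~~ single c x -> movable c x.
Proof. by rewrite /movable /stuck => -> /negbTE->. Qed.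

Lemma nmovable_single c x : free c x -> ~~ movable c x -> stuck c x.
Proof. by rewrite /movable => -> /=; rewrite negbK. Qed.

Lemma split_single c d s A B t x : splits c d s A B t ->
  single d x -> single c x.
Proof.
move=> cd /singleP sx; apply/singleP=> w e; apply: sx.
by rewrite !(split_idx cd) e.
Qed.

(** If an element w leaves the block of j when {x} is cut out, then either
w = x or x = j; these are the two cases in the definition of free. *)
Lemma cut_top2 c d s x I t :
  splits c d s [set x] I t -> free d x -> top2 c = top2 d.
Proof.
move=> cd /freeP[xL h1 h2]; apply: (split_top2 cd) => w; rewrite -(split_last cd) => wL wj.
have [_ _ h3] := top2P d.
have [e|/eqP ne] := eqVneq (idx d w) (idx d (top1 d)); last exact: h3.
have [xj|/eqP xj] := eqVneq x (top1 d).
  by apply: h2 => // e'; apply: wj; rewrite e' (split_top1 cd).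
have wx : w = x.
  apply/set1P; rewrite (split_mem1 cd).
  have := split_mem1 cd (top1 c); rewrite inE -(split_top1 cd) eq_sym.
  move/eqP/negbTE: (xj) => ->; move: e wj; rewrite -(split_top1 cd) !(split_idx cd).
  by lia.
by rewrite wx; apply: h1.
Qed.

Lemma merged_not_single c d s x I t :
  splits c d s [set x] I t -> ~~ single d x.
Proof.
move=> cd; apply/negP=> /singleP h.
have [w wk] : exists w, idx c w = (size s).+1.
  by apply: idx_surj; have := split_pos cd; lia.
have xk : idx c x = size s by apply/eqP; rewrite -(split_mem1 cd) set11.
have wx : w = x by apply: h; rewrite !(split_idx cd) xk wk; lia.
by rewrite wx xk in wk; lia.
Qed.

(** Here {z} is one of the blocks of both cells, as z <> y and the merged block
is not a singleton; a decreasing run starting at z is transported because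
positions in the face determine those in d monotonically. *)
Lemma stuck_split c d s y I t z : splits c d s [set y] I t ->
  top2 c = top2 d -> z < y -> stuck d z -> stuck c z.
Proof.
move=> cd e2 zy /andP[sz st]; rewrite /stuck (split_single cd sz) /=.
have yk : idx c y = size s by apply/eqP; rewrite -(split_mem1 cd) set11.
have zk : idx d z <> size s.
  move=> e; have yz : y = z; last by rewrite yz ltnn in zy.
  by move/singleP: sz; apply; move: e; rewrite !(split_idx cd) yk; lia.
case/orP: st => [/andP[/eqP zi /eqP ij]|/decrP de]; apply/orP; [left|right].
- rewrite e2 zi eqxx /=; apply/eqP; rewrite (split_top1 cd) in ij.
  have [h1 h2 h3] := top2P c; rewrite e2 in h1 h2 h3.
  have yL : y \notin lastb c by rewrite notin_last yk; have := split_pos cd; lia.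
  have h4 := h3 y yL; rewrite yk in h4.
  (* With z = i, an element y > i that forms a block can only be j. *)
  have h5 : ~ y <= top2 d by rewrite -zi; lia.
  rewrite zi in ij zk; move: ij zk; rewrite !(split_idx cd); lia.
- apply/decrP=> w w' wL w'L h1 h2; apply: de; rewrite ?(split_last cd) //.
  by rewrite !(split_idx cd); lia.
  by rewrite !(split_idx cd); lia.
Qed.

(** The decreasing run starting at z < y cannot contain y.  If it lies behind
the merged block it persists; the only way to destroy it is to merge {y} with
{z} itself, but then the run starting at y is decreasing too and y is stuck. *)
Lemma stuck_merge c d s y I t z : splits c d s [set y] I t ->
  top2 c = top2 d -> ascending c -> z < y -> ~~ stuck c y ->
  z \notin lastb c -> stuck c z -> stuck d z.
Proof.
move=> cd e2 /ascendingE ac zy nsy zL /andP[sz st].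
have yk : idx c y = size s by apply/eqP; rewrite -(split_mem1 cd) set11.
have ysing : single c y.
  by apply/singleP=> w; rewrite yk => /eqP; rewrite -(split_mem1 cd) inE => /eqP.
have yL : y \notin lastb c by rewrite notin_last yk; have := split_pos cd; lia.
have yz : idx c y <> idx c z.
  by move=> e; move/singleP: sz => /(_ _ e) e'; rewrite e' ltnn in zy.
case/orP: st => [/andP[/eqP zi /eqP ij]|].
- have [h1 h2 h3] := top2P c.
  have yj : y = top1 c.
    move/singleP: ysing => ysing.
    apply/esym/ysing; apply/eqP; apply/negP=> /negP/eqP ne.
    by have := h3 y yL; rewrite -zi => /(_ ltac:(congruence)); lia.
  rewrite -yj in ij; rewrite /stuck -e2 -zi (split_top1 cd) -yj eqxx.
  rewrite (_ : single d z); last first.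
    apply/singleP=> w e; move/singleP: sz; apply.
    by move: e ij; rewrite !(split_idx cd) yk; lia.
  have -> : idx d y = (idx d z).+1 by rewrite !(split_idx cd); lia.
  by rewrite eqxx.
- move/decrP=> de.
  have zpos : size s < idx c z.
    rewrite ltnNge; apply/negP => h.
    by have := de z y zL yL; rewrite yk leqnn => /(_ isT h); lia.
  have zpos1 : (size s).+1 < idx c z.
    rewrite ltn_neqAle zpos andbT; apply/eqP=> zk.
    case/negP: nsy; rewrite /stuck ysing /=; apply/orP; right.
    apply/decrP=> w w' wL w'L h1 h2.
    have [wy|/eqP wy] := eqVneq w y; last first.
      apply: de => //; rewrite -zk ltn_neqAle -yk h1 andbT; apply/eqP=> e.
      by move/singleP: ysing => /(_ w (esym e)).
    rewrite wy; have [->//|/eqP w'y] := eqVneq w' y.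
    apply: leq_trans (ltnW zy); apply: de => //.
    rewrite -zk ltn_neqAle -yk -{2}wy h2 andbT; apply/eqP=> e.
    by move/singleP: ysing => /(_ w' (esym e)).
  have ded : decr d z.
    apply/decrP=> w w'; rewrite (split_last cd) => wL w'L h1 h2; apply: de => //.
      by move: h1; rewrite !(split_idx cd); lia.
    by move: h1 h2; rewrite !(split_idx cd); lia.
  by rewrite /stuck ded orbT andbT; apply: decr_single; rewrite ?(split_last cd).
Qed.

Lemma locate c x : exists s B t, [/\ blocks c = s ++ B :: t, x \in B & size s = idx c x].
Proof.
exists (take (idx c x) c), (nth set0 c (idx c x)), (drop (idx c x).+1 c); split.
- by rewrite -drop_nth ?cat_take_drop // idx_lt.
- by rewrite mem_nth_cell // idx_lt.
- by rewrite size_takel // ltnW // idx_lt.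
Qed.

Lemma cut_exists c x : x \notin lastb c -> ~~ single c x ->
  exists a s I t, splits a c s [set x] I t /\ ord_max \notin I.
Proof.
move=> xL ns; have [s [B [t [E xB xs]]]] := locate c x.
have tn : 0 < size t.
  by move: xL; rewrite notin_last E size_cat /= -E -xs; lia.
pose I := B :\ x.
have I0 : I <> set0.
  move=> I0; case/negP: ns; apply/singleP=> w /eqP; rewrite -xs -(idx_cat _ E).
  move=> wB; apply/eqP/negP=> /negP wx.
  by have : w \in I; [rewrite !inE wx | rewrite I0 inE].
have BE : [set x] :|: I = B by rewrite setD1K.
have cell : is_cell (s ++ [set x] :: I :: t).
  case/and3P: (cellP c); rewrite E => /ordered_partitionP[n0 cnt] la sz.
  apply/and3P; split.
  - apply/ordered_partitionP; split.
      move: n0; rewrite !mem_cat !inE !negb_or => /and3P[-> _ ->].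
      rewrite !andbT /= !(eq_sym set0); apply/andP; split; last exact/eqP.
      by apply/set0Pn; exists x; rewrite set11.
    move=> w; rewrite -(cnt w) !count_cat /= -BE !inE.
    by case: (w == x).
  - by move: la tn; case: (t) => //= T t'; rewrite !last_cat.
  - by move: sz; rewrite !size_cat /=; lia.
exists (Cell cell), s, I, t; split.
  by split=> //=; rewrite BE.
have := cell_last c; rewrite mem_last_cell => nl.
rewrite !inE negb_and; apply/orP; right; rewrite (idx_cat _ E).
by move: nl; rewrite E size_cat /=; lia.
Qed.

(** Not being stuck provides a next block other than the last one; it also
keeps i and j in distinct blocks after the merge, which implies both that the
result has at least three blocks and that its class is the same. *)
Lemma merge_exists c x : ascending c -> x \notin lastb c -> single c x ->
  ~~ stuck c x ->
  exists d s I t, [/\ splits c d s [set x] I t, ord_max \notin I &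
     idx d (top2 c) <> idx d (top1 c)].
Proof.
move=> /ascendingE ac xL sx nst; have [s [B [t [E xB xs]]]] := locate c x.
have BE : B = [set x].
  apply/setP=> w; rewrite (idx_cat _ E) inE xs; apply/eqP/eqP=> [|->//].
  exact: (elimT (singleP c x)).
rewrite {}BE {xB} in E.
have szc : size c = size s + (size t).+1 by rewrite E size_cat.
have tn : 0 < size t by move: xL; rewrite notin_last szc -xs; lia.
case: t tn E szc => // I t _ E szc /=.
have ij : ~ (idx c (top2 c) = size s /\ idx c (top1 c) = (size s).+1).
  move=> [ei ej]; case/negP: nst; rewrite /stuck sx /=; apply/orP; left.
  rewrite -xs ej eqxx andbT eq_sym; apply/eqP; apply: (elimT (singleP c x)) => //.
  by rewrite ei xs.
have [g1 _] := top1P c; rewrite notin_last in g1.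
have tn : 0 < size t.
  case: (posnP (size t)) => // t0; case/negP: nst; rewrite /stuck sx /=.
  apply/orP; right; apply/decrP=> w w'; rewrite !notin_last szc /= t0 -xs => h1 h2 h3 h4.
  have -> : w = x by apply: (elimT (singleP c x)) => //; lia.
  have -> // : w' = x by apply: (elimT (singleP c x)) => //; lia.
have cell : is_cell (s ++ ([set x] :|: I) :: t).
  case/and3P: (cellP c); rewrite E => /ordered_partitionP[n0 cnt] la sz.
  apply/and3P; split.
  - apply/ordered_partitionP; split.
      move: n0; rewrite !mem_cat !inE !negb_or => /and4P[-> _ _ ->].
      rewrite andbT eq_sym /=; apply/set0Pn; exists x; by rewrite !inE eqxx.
    move=> w; move: (cnt w); rewrite !count_cat /= !inE.
    by case: (w == x); case: (w \in I) => /=; lia.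
  - by move: la tn; case: (t) => //= T t'; rewrite !last_cat.
  - by rewrite size_cat /=; move: ij g1 ac szc; rewrite /=; lia.
have cd : splits c (Cell cell) s [set x] I t by [].
exists (Cell cell), s, I, t; split=> //.
  rewrite (split_mem2 cd); have := cell_last c; rewrite mem_last_cell szc /=; lia.
by rewrite !(split_idx cd); move: ij ac; lia.
Qed.


(** * The cells paired up to a given step *)

Lemma splits_last_notin a b s I t x :
  splits a b s [set x] I t -> x \notin lastb a.
Proof.
move=> ab; have := split_pos ab.
have : x \in [set x] by rewrite set11.
by rewrite (split_mem1 ab) notin_last => /eqP ->; lia.
Qed.

Lemma splits_single a b s I t x : splits a b s [set x] I t -> single a x.
Proof.
move=> ab; apply/singleP=> w; have := split_mem1 ab x; rewrite set11 => /esym/eqP ->.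
by move/eqP; rewrite -(split_mem1 ab) inE => /eqP.
Qed.

Lemma paired_at_splits x e a b : paired_at x e a b ->
  exists s I t, splits a b s [set x] I t.
Proof.
move=> [[s [t [I [Ea Eb nI]]]] _]; exists s, I, t; split=> //.
have := cell_last a; rewrite Ea last_cat /=.
by case: (t) => //= nI'; rewrite nI' in nI.
Qed.

Lemma paired_at_class x e a b : paired_at x e a b ->
  [/\ ascending a, ascending b & top2 a = top2 b].
Proof.
move=> [_ [_ _ aa ecl]]; have ab : ascending b by move: aa; rewrite /ascending ecl.
by split=> //; move: ecl; rewrite !cl_ascending // => -[].
Qed.

(** By induction on the number of steps: a cell whose least movable element is
y = k can be merged or cut at y with the class preserved, and its partner has
no movable element below y, hence is still unpaired by the induction
hypothesis. *)
Lemma paired_uptoP k c : paired_upto k c <->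
  ascending c /\ exists y : 'I_n.+1, y < k /\ movable c y.
Proof.
elim: k c => [|k IH] c; first by split=> [//|[_ [y []]]].
split.
- case=> [/IH[ac [y [yk mv]]]|[x [d [xk pr]]]].
    by split=> //; exists y; split=> //; apply: ltnW.
  suff [ac ad mc] : [/\ ascending c, ascending d & movable c x].
    by split=> //; exists x; rewrite xk.
  have main a b : paired_at x (paired_upto k) a b ->
      [/\ ascending a, ascending b, movable a x & movable b x].
    move=> pab; have [s [I [t ab]]] := paired_at_splits pab.
    have [aa ascb e2] := paired_at_class pab.
    have xL := splits_last_notin ab.
    have fa : free a x by apply: single_free (splits_single ab).
    have fb : free b x by rewrite -(free_eq _ (esym (split_last ab)) e2).
    have mb : movable b x by apply: movable_nsingle (merged_not_single ab).
    split=> //; rewrite /movable fa /=; apply/negP=> /andP[_ /orP[]].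
      (* Here x = i and j is in the next block, so i and j would be merged. *)
      move=> /andP[/eqP xi /eqP ij]; move/ascendingE: ascb.
      have := split_mem1 ab x; rewrite set11 => /esym/eqP xs.
      rewrite -e2 -xi (split_top1 ab) !(split_idx ab) ij xs; lia.
    (* In a decreasing run I = {w} with w < x, and w is movable in the merge
       b, which therefore was paired at an earlier step. *)
    move=> de; have [w wI] : exists w, w \in I.
      by apply: (@cell_neq0 a); case: ab => -> _ _; rewrite mem_cat !inE eqxx !orbT.
    have := split_mem1 ab x; rewrite set11 => /esym/eqP xs.
    move: wI; rewrite (split_mem2 ab) => /eqP ws.
    have wL : w \notin lastb a by rewrite notin_last ws; have := split_pos ab; lia.
    have wx : w < x.
      rewrite ltn_neqAle (elimT (decrP a x) de) // ?ws ?xs ?leqnn // andbT.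
      by apply/eqP=> /val_inj e; rewrite e xs in ws; lia.
    have dw : decr a w.
      by apply/decrP=> u v uL vL h1 h2; apply: (elimT (decrP a x) de) => //; lia.
    have fw : free b w.
      rewrite -(free_eq _ (esym (split_last ab)) e2).
      by apply: single_free (decr_single wL dw).
    case: pab => _ [_ + _ _]; apply; apply/IH; split=> //; exists w; split; first by rewrite -xk.
    apply: movable_nsingle => //; apply/negP=> /singleP/(_ x); rewrite !(split_idx ab) ws xs.
    by move=> /(_ ltac:(lia)) e; rewrite e ltnn in wx.
  by case: pr => /main[].
- case=> ac [y [yk mv]]; have [pk|npk] := boolP [exists z : 'I_n.+1, (z < k) && movable c z].
    left; apply/IH; split=> //; case/existsP: pk => z /andP[zk mz]; by exists z.
  have {}npk z : z < k -> ~ movable c z.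
    by move=> zk mz; case/negP: npk; apply/existsP; exists z; rewrite zk.
  have yk' : y = k :> nat by have [/npk //||//] := ltngtP y k; lia.
  case/andP: (mv) => fy nst; have [yL _ _] := freeP c y fy.
  have ncp : ~ paired_upto k c by move=> /IH[_ [z [/npk nz]]]; apply: nz.
  right; exists y.
  have [sy|nsy] := boolP (single c y).
  + have [d [s [I [t [cd nI ne]]]]] := merge_exists ac yL sy nst.
    have e2 := merge_top2 cd ne; have ad := merge_asc cd ac ne.
    exists d; split=> //; left; split.
      by exists s, t, I; case: cd.
    split=> //; last by rewrite !cl_ascending // e2 (split_top1 cd).
    move=> /IH[_ [z [zk /andP[fz nsz]]]]; apply: (npk z zk).
    have fz' : free c z by rewrite (free_eq _ (esym (split_last cd)) (esym e2)).
    rewrite /movable fz' /=; apply: contra nsz => stz.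
    by case/freeP: fz' => zL _ _; apply: (stuck_merge cd) stz; rewrite ?e2 ?yk'.
  + have [a [s [I [t [cd nI]]]]] := cut_exists yL nsy.
    have e2 := cut_top2 cd fy; have aa := split_asc cd e2 ac.
    exists a; split=> //; right; split.
      by exists s, t, I; case: cd.
    split=> //; last by rewrite !cl_ascending // e2 (split_top1 cd).
    move=> /IH[_ [z [zk /andP[fz nsz]]]]; apply: (npk z zk).
    have fz' : free c z by rewrite -(free_eq _ (esym (split_last cd)) e2).
    rewrite /movable fz' /=; apply: contra nsz => stz.
    by apply: (stuck_split cd e2) stz; rewrite yk'.
Qed.

Lemma paired_upto_r x a b : paired_at x (paired_upto x) a b ->
  paired_upto x.+1 a /\ paired_upto x.+1 b.
Proof.
move=> p; split; right; exists x; [exists b | exists a]; split=> //; by [left|right].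
Qed.

Lemma paired_at_movable x a b : paired_at x (paired_upto x) a b ->
  [/\ movable a x, movable b x, (forall z, z < x -> ~~ movable a z) &
      (forall z, z < x -> ~~ movable b z)].
Proof.
move=> p; have [/paired_uptoP[aa [y [yx my]]] /paired_uptoP[ab [w [wx mw]]]] :=
  paired_upto_r p.
case: p => _ [na nb _ _].
have na' z : z < x -> ~~ movable a z.
  by move=> zx; apply/negP=> mz; apply: na; apply/paired_uptoP; split=> //; exists z.
have nb' z : z < x -> ~~ movable b z.
  by move=> zx; apply/negP=> mz; apply: nb; apply/paired_uptoP; split=> //; exists z.
split=> //.
- suff <- : y = x by []. 
  by apply/val_inj/eqP; rewrite /= eqn_leq -ltnS yx leqNgt; apply/negP=> /na'; rewrite my.
- suff <- : w = x by []. 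
  by apply/val_inj/eqP; rewrite /= eqn_leq -ltnS wx leqNgt; apply/negP=> /nb'; rewrite mw.
Qed.

(** The step is the least movable element of either member of the pair. *)
Lemma same_step x x' a b a' b' c :
  paired_at x (paired_upto x) a b -> paired_at x' (paired_upto x') a' b' ->
  c = a \/ c = b -> c = a' \/ c = b' -> x = x'.
Proof.
move=> /paired_at_movable[ma mb na nb] /paired_at_movable[ma' mb' na' nb'] h h'.
have [mc nc] : movable c x /\ (forall z, z < x -> ~~ movable c z) by case: h => ->.
have [mc' nc'] : movable c x' /\ (forall z, z < x' -> ~~ movable c z) by case: h' => ->.
apply/val_inj; case: (ltngtP x x') => // [/nc'|/nc]; by rewrite ?mc ?mc'.
Qed.

Lemma cat_cons_inj s s' A A' t t' : size s = size s' ->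
  s ++ A :: t = s' ++ A' :: t' -> [/\ s = s', A = A' & t = t'].
Proof. by move=> e /eqP; rewrite eqseq_cat // => /andP[/eqP-> /eqP[-> ->]]. Qed.

Lemma splits_size_idx a b s x I t : splits a b s [set x] I t ->
  size s = idx a x /\ size s = idx b x.
Proof.
move=> ab; have := split_mem1 ab x; rewrite set11 => /esym/eqP xs.
by rewrite (split_idx ab) xs; split=> //; lia.
Qed.

Lemma splits_notin a b s x I t : splits a b s [set x] I t -> x \notin I.
Proof.
by move=> ab; rewrite (split_mem2 ab); have [<- _] := splits_size_idx ab; lia.
Qed.

Lemma splits_inj_l a b b' s x I t s' I' t' :
  splits a b s [set x] I t -> splits a b' s' [set x] I' t' -> b = b'.
Proof.
move=> ab ab'; have [e _] := splits_size_idx ab; have [e' _] := splits_size_idx ab'.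
case: ab => Ea Eb _; case: ab' => Ea' Eb' _; apply: val_inj; rewrite /= Eb Eb'.
by rewrite Ea in Ea'; have [|-> _ [-> ->]] := cat_cons_inj _ Ea'; first by rewrite e e'.
Qed.

Lemma splits_inj_r a a' b s x I t s' I' t' :
  splits a b s [set x] I t -> splits a' b s' [set x] I' t' -> a = a'.
Proof.
move=> ab ab'; have [_ e] := splits_size_idx ab; have [_ e'] := splits_size_idx ab'.
have nI := splits_notin ab; have nI' := splits_notin ab'.
case: ab => Ea Eb _; case: ab' => Ea' Eb' _; apply: val_inj; rewrite /= Ea Ea'.
rewrite Eb in Eb'; have [|-> EI ->] := cat_cons_inj _ Eb'; first by rewrite e e'.
by rewrite -(setU1K nI) -(setU1K nI') EI.
Qed.

(** * The pairing is a discrete vector field *)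

Lemma V_vector_field : discrete_vector_field (@QP_dim n) (@QP_incl n) (@V n).
Proof.
split.
- move=> _ _ [a [b [[x [_ p]] -> ->]]]; rewrite !QP_dim_bar /CP_dim.
  have [s [I [t ab]]] := paired_at_splits p.
  have sa := split_size ab; have := cell_size_le a; split; first by lia.
  exists a, b; split=> //; exists 0, ([seq [:: B] | B <- s] ++ [:: [set x]; I] ::
    [seq [:: B] | B <- t]).
  case: ab => -> -> _; rewrite rot0 map_cat flatten_cat /= !flatten_seq1; split=> //.
  rewrite -!map_comp !big_cons big_nil setU0; congr (_ ++ _ :: _); apply/esym.
  + by rewrite -[RHS]map_id; apply: eq_map => B /=; rewrite big_seq1.
  + by rewrite -[RHS]map_id; apply: eq_map => B /=; rewrite big_seq1.
- move=> _ _ _ _ [a [b [[x [_ p]] -> ->]]] [a' [b' [[x' [_ p']] -> ->]]] h.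
  have [aa ab _] := paired_at_class p; have [aa' ab' _] := paired_at_class p'.
  have [s [I [t S]]] := paired_at_splits p; have [s' [I' [t' S']]] := paired_at_splits p'.
  have na := splits_single S; have nb := merged_not_single S.
  have na' := splits_single S'; have nb' := merged_not_single S'.
  have [c hc hc'] : exists2 c, c = a \/ c = b & c = a' \/ c = b'.
    by case: h => /bar_asc_inj e; [exists a|exists a|exists b|exists b]; auto.
  have xx := same_step p p' hc hc'; rewrite -xx in na' nb' S'.
  case: h => /bar_asc_inj e.
  + have {}e := e aa aa'; rewrite -e in S' *; by rewrite (splits_inj_l S S').
  + by have {}e := e aa ab'; rewrite e in na; rewrite na in nb'.
  + by have {}e := e ab aa'; rewrite e in nb; rewrite na' in nb.
  + have {}e := e ab ab'; rewrite -e in S' *; by rewrite (splits_inj_r S S').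
Qed.


(** * Faces with the same last block *)

Local Notation union := (fun s : seq block => \bigcup_(B <- s) B).

Lemma mem_union s x : (x \in union s) = has (fun B : block => x \in B) s.
Proof. by elim: s => [|B s IH]; rewrite ?big_nil ?inE // big_cons inE IH. Qed.

Lemma incl_last c d : CP_incl c d -> lastb c \subset lastb d.
Proof.
move=> [j [ss [Ec Ed]]].
have : lastb c \in flatten ss.
  by rewrite Ec mem_rot blocks_rcons last_rcons mem_rcons mem_head.
case/flattenP=> s sss Ls.
have Ls' : lastb c \subset union s.
  by apply/subsetP=> x xL; rewrite mem_union; apply/hasP; exists (lastb c).
suff <- : union s = lastb d by [].
have nU : ord_max \in union s by apply: (subsetP Ls'); apply: cell_last.
have Us : union s \in blocks d by rewrite Ed; apply: map_f.
have := cell_last d; rewrite mem_last_cell => /eqP nd.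
move: nU; rewrite -(nth_index set0 Us) mem_nth_cell ?index_mem // nd => /eqP <-.
by rewrite nth_last.
Qed.

Lemma size_flatten_ge (T : Type) (ss : seq (seq T)) :
  all (fun u : seq T => 0 < size u) ss -> size ss <= size (flatten ss).
Proof. by elim: ss => //= u ss IH /andP[u0 /IH]; rewrite size_cat; lia. Qed.

Lemma union_runs0 (ss : seq (seq block)) :
  all (fun s => 0 < size s) ss -> size (flatten ss) = size ss ->
  map union ss = flatten ss.
Proof.
elim: ss => //= s ss IH /andP[s0 ss0]; rewrite size_cat.
have := size_flatten_ge ss0; case: s s0 => // B [|? ?] _ /= h; last by lia.
by move=> [e]; rewrite big_seq1 IH.
Qed.

Lemma union_runs1 (ss : seq (seq block)) :
  all (fun s => 0 < size s) ss -> size (flatten ss) = (size ss).+1 ->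
  exists s A B t, flatten ss = s ++ A :: B :: t /\ map union ss = s ++ (A :|: B) :: t.
Proof.
elim: ss => //= s ss IH /andP[s0 ss0]; rewrite size_cat.
have := size_flatten_ge ss0; case: s s0 => // A [|B [|? ?]] _ /= h; last by lia.
- move=> [e]; have [//|s [A' [B' [t [-> ->]]]]] := IH ss0.
  by exists (A :: s), A', B', t; rewrite big_seq1.
- move=> [e]; exists [::], A, B, (flatten ss).
  by rewrite !big_cons big_nil setU0 union_runs0.
Qed.

(** If L is a block of the face, then the run of blocks with union L is [:: L],
so the rotation is trivial; by the count of blocks exactly one of the remaining
runs has two elements, and the others have one. *)
Lemma incl_splits c d : CP_incl c d -> lastb c = lastb d ->
  size c = (size d).+1 -> exists s A B t, splits c d s A B t.
Proof.
move=> [j [ss [Ec Ed]]] eL sz.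
have uss : uniq (flatten ss) by rewrite Ec rot_uniq cell_uniq.
have mss B : (B \in flatten ss) = (B \in blocks c) by rewrite Ec mem_rot.
have ne0 : all (fun s => 0 < size s) ss.
  apply/allP=> s sss; have : union s \in blocks d by rewrite Ed; apply: map_f.
  by case/cell_neq0=> x; rewrite mem_union has_count => /leq_trans->//; apply: count_size.
case/lastP: ss Ec Ed uss mss ne0 => [|ss l] Ec Ed uss mss ne0.
  by have := cell_size d; rewrite Ed.
have lE : union l = lastb c by rewrite eL Ed map_rcons last_rcons.
have Lc : lastb c \in blocks c by rewrite {2}blocks_rcons mem_rcons mem_head.
(* All blocks of the run l lie in the block L, hence equal it. *)
have l1 : l = [:: lastb c].
  have all1 : {subset l <= [:: lastb c]}.
    move=> B Bl; rewrite inE; have Bc : B \in blocks c.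
      by rewrite -mss flatten_rcons mem_cat Bl orbT.
    have [x xB] := cell_neq0 Bc.
    have : x \in lastb c by rewrite -lE mem_union; apply/hasP; exists B.
    rewrite mem_last_cell => /eqP xl.
    move: xB; rewrite -(nth_index set0 Bc) mem_nth_cell ?index_mem // xl => /eqP <-.
    by rewrite nth_last.
  have ul : uniq l by move: uss; rewrite flatten_rcons cat_uniq => /and3P[].
  have l0 : 0 < size l by move: ne0; rewrite all_rcons => /andP[].
  case: l all1 ul l0 {lE Ec Ed uss mss ne0} => // B [|B' l] all1 ul _.
    by have := all1 B (mem_head _ _); rewrite inE => /eqP->.
  have := all1 B (mem_head _ _); have := all1 B'; rewrite !inE eqxx orbT => /(_ isT).
  by move: ul; rewrite /= inE => + /eqP e /eqP e'; rewrite e e' eqxx.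
rewrite l1 flatten_rcons in Ec; rewrite l1 map_rcons big_seq1 in Ed.
have {}Ec : blocks c = flatten ss ++ [:: lastb c].
  have [jc|jc] := leqP (size c) j; first by rewrite Ec rot_oversize.
  case: (posnP j) => [j0|j0]; first by rewrite Ec j0 rot0.
  have : last set0 (rot j c) = lastb c by rewrite -Ec last_cat.
  rewrite /rot last_cat -nth_last size_takel ?(ltnW jc) //.
  rewrite (set_nth_default set0) ?size_takel; try lia.
  rewrite nth_take; last lia.
  have h1 : j.-1 < size c by lia.
  have h2 : (size c).-1 < size c by lia.
  by rewrite -nth_last => /eqP; rewrite (nth_uniq _ h1 h2 (cell_uniq c)) => /eqP; lia.
rewrite all_rcons in ne0; case/andP: ne0 => _ ne0.
have [|s [A [B [t [E1 E2]]]]] := union_runs1 ne0.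
  by move: sz; rewrite Ec Ed size_cat size_rcons size_map /=; lia.
exists s, A, B, (rcons t (lastb c)); split; last by rewrite size_rcons.
- by rewrite [LHS]Ec E1 -catA /= cats1.
- by rewrite [LHS]Ed E2 rcons_cat.
Qed.

Lemma splits_r c d s A B t : splits c d s A B t ->
  exists s' A' B' t', splits (r c) (r d) s' A' B' t'.
Proof.
case=> Ec Ed; case/lastP: t Ec Ed => // t L Ec Ed _.
exists (rev t), B, A, (rcons (rev s) L); split; last by rewrite size_rcons.
- rewrite /= Ec -rcons_cons -rcons_cons -rcons_cat /r_seq rev_rcons rot1_cons.
  by rewrite rev_cat !rev_cons !rcons_cat -!cats1 -!catA.
- rewrite /= Ed -rcons_cons -rcons_cat /r_seq rev_rcons rot1_cons setUC.
  by rewrite rev_cat !rev_cons !rcons_cat -!cats1 -!catA.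
Qed.

(** * Absence of closed paths *)

Definition right_of c x := [set w | (w \notin lastb c) && (idx c x < idx c w)].

(** Elements in other blocks than {x} are strictly on one side of x both
before and after the cut. *)
Lemma right_of_split c d s A B t x : splits c d s A B t -> single d x ->
  right_of c x = right_of d x.
Proof.
move=> cd /singleP sx; apply/setP=> w; rewrite !inE (split_last cd); congr (_ && _).
have [->|/eqP wx] := eqVneq w x; first by rewrite !ltnn.
have : idx d w <> idx d x by move/sx.
by rewrite !(split_idx cd); lia.
Qed.

(** The cut must separate {x} from the rest of the block {x} u I, and as a' is
not a, it puts {x} behind I: the elements of I are no longer to the right. *)
Lemma right_of_swap a a' b x s I t s' A B t' :
  splits a b s [set x] I t -> splits a' b s' A B t' -> single a' x -> a' <> a ->
  right_of a' x \proper right_of a x.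
Proof.
move=> ab a'b sx ne; have [es es'] := splits_size_idx ab.
have e : idx b x = size s'.
  apply/eqP; apply: contraNT (merged_not_single ab) => xs; apply/singleP=> w e.
  apply: (elimT (singleP a' x)) => //; move: xs e; rewrite !(split_idx a'b); lia.
have [Ea Eb _] := ab; have [Ea' Eb' _] := a'b.
have [ss EU tt] : [/\ s = s', [set x] :|: I = A :|: B & t = t'].
  by apply: cat_cons_inj; rewrite -?Eb -?Eb' // es' e.
have nI := splits_notin ab.
have [xA|xA] := boolP (x \in A).
  case: ne; apply: val_inj; rewrite /= Ea Ea' ss tt.
  have AE : A = [set x].
    apply/setP=> w; rewrite inE; apply/idP/eqP => [|->//].
    rewrite (split_mem1 a'b); move: xA; rewrite (split_mem1 a'b) => /eqP <- /eqP.
    exact: (elimT (singleP a' x)).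
  have xB : x \notin B.
    by rewrite (split_mem2 a'b); move: xA; rewrite (split_mem1 a'b) => /eqP->; lia.
  by rewrite AE in EU *; rewrite -(setU1K nI) -(setU1K xB) -EU.
have xk : idx a' x = (size s).+1.
  by move: xA e; rewrite (split_mem1 a'b) (split_idx a'b) ss; lia.
apply/properP; split.
  apply/subsetP=> w; rewrite !inE xk -(split_last ab) (split_last a'b) => /andP[-> wk] /=.
  have : idx b w > size s by rewrite (split_idx a'b) -ss; lia.
  by rewrite (split_idx ab) -es; lia.
have [w wk] : exists w, idx a w = (size s).+1.
  by apply: idx_surj; have := split_pos ab; lia.
have wb : idx b w = size s by rewrite (split_idx ab) wk; lia.
exists w; rewrite inE.
  by rewrite notin_last wk -es; have := split_pos ab; lia.
by move: wb; rewrite xk (split_idx a'b) -ss; lia.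
Qed.

Lemma closed_mono (f : nat -> nat) T :
  (forall t : nat, t < T -> f t.+1 <= f t) -> f T = f 0 ->
  forall t : nat, t < T -> f t.+1 = f t.
Proof.
move=> mono fT t tT; apply/eqP; rewrite eqn_leq mono //=.
have le0 u : u <= T -> f u <= f 0.
  by elim: u => // u IH uT; apply: leq_trans (mono _ uT) (IH (ltnW uT)).
have leT u : u <= T -> f T <= f (T - u).
  elim: u => [|u IH] uT; first by rewrite subn0.
  apply: leq_trans (IH (ltnW uT)) _; rewrite -(_ : (T - u.+1).+1 = T - u); last by lia.
  by apply: mono; lia.
apply: leq_trans (le0 t (ltnW tT)) _; rewrite -fT.
by have := leT (T - t.+1); rewrite subKn //; apply; lia.
Qed.

Lemma bar_asc_rep (u : QP n) : bar (asc_rep u) = u.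
Proof.
have h : bar (repr u) = u by rewrite /bar generic_quotient.reprK.
by rewrite /asc_rep; case: ifP => _; rewrite ?bar_r.
Qed.

Lemma bar_cases c (u : QP n) : bar c = u -> c = asc_rep u \/ c = r (asc_rep u).
Proof.
move=> h; have /eqP : bar (asc_rep u) = bar c by rewrite bar_asc_rep.
by rewrite bar_eq => /orP[]/eqP->; auto.
Qed.

(** The invariants are treated in the order L, i, then the sets right_of, as
each of them is monotone only once the previous ones are known to be constant.
Instead of choosing the smallest step of the path, nomove shows by induction on
m that no element below m is ever movable. *)
Lemma V_acyclic p T (sigma tau : nat -> QP n) :
  V_path (@QP_dim n) (@QP_incl n) (@V n) p T sigma tau -> sigma 0 <> sigma T.
Proof.
move=> [T0 dims dimt step] closed.
pose alpha (t : nat) := asc_rep (sigma t); pose beta (t : nat) := asc_rep (tau t).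
have aT : alpha T = alpha 0 by rewrite /alpha closed.
have pr (t : nat) : t < T -> exists x, paired_at x (paired_upto x) (alpha t) (beta t).
  move=> /step[[a [b [[x [_ pab]] es et]]] _ _]; exists x.
  have [aa ab _] := paired_at_class pab.
  by rewrite /alpha /beta es et !asc_rep_bar.
have ba (t : nat) : bar (alpha t) = sigma t by apply: bar_asc_rep.
have bb (t : nat) : bar (beta t) = tau t by apply: bar_asc_rep.
have ca c (t : nat) : bar c = sigma t -> c = alpha t \/ c = r (alpha t).
  exact: bar_cases.
have cb c (t : nat) : bar c = tau t -> c = beta t \/ c = r (beta t).
  exact: bar_cases.
have ca' c (t : nat) : ascending c -> bar c = sigma t -> c = alpha t.
  by move=> ac e; rewrite /alpha -e asc_rep_bar.
clearbody alpha beta.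
have neq (t : nat) : t < T -> alpha t.+1 <> alpha t.
  by move=> /step[_ _ ne] e; apply: ne; rewrite -!ba e.
have pL (t : nat) : t < T -> lastb (beta t) = lastb (alpha t).
  by move/pr=> [x /paired_at_splits[s [I [u S]]]]; rewrite (split_last S).
have top2ab (t : nat) : t < T -> top2 (beta t) = top2 (alpha t).
  by move/pr=> [x /paired_at_class[]].
have sizes (t : nat) : t < T -> size (alpha t.+1) = (size (beta t)).+1.
  move=> tT; have := dims _ tT; have := dimt _ tT.
  rewrite -ba -bb !QP_dim_bar /CP_dim.
  by have := cell_size_le (alpha t.+1); have := cell_size_le (beta t); lia.
have sub (t : nat) : t < T -> lastb (alpha t.+1) \subset lastb (alpha t).
  move=> tT; rewrite -(pL t) //; have [_ [c [d [/ca ec /cb ed /incl_last cd]]] _] := step t tT.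
  by move: cd; case: ec => ->; case: ed => ->; rewrite ?last_r.
have eL (t : nat) : t < T -> lastb (alpha t.+1) = lastb (alpha t).
  move=> tT; apply/eqP; rewrite eqEcard sub //=.
  rewrite (closed_mono (f := fun t : nat => #|lastb (alpha t)|) _ _ tT) ?aT //.
  by move=> u uT; apply/subset_leq_card/sub.
have spl (t : nat) : t < T -> exists c, bar c = sigma t.+1 /\
    exists s A B u, splits c (beta t) s A B u.
  move=> tT; have [_ [c [d [bc bd cd]]] _] := step t tT.
  have lc : lastb c = lastb (alpha t).
    by case/ca: (bc) => ->; rewrite ?last_r eL.
  have ld : lastb d = lastb (alpha t).
    by case/cb: (bd) => ->; rewrite ?last_r pL.
  have sc : size c = (size d).+1.
    by case/ca: (bc) => ->; case/cb: (bd) => ->; rewrite ?size_r; apply: sizes.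
  have [|s [A [B [u S]]]] := incl_splits cd _ sc; first by rewrite lc.
  case/cb: bd => ed; first by exists c; split=> //; exists s, A, B, u; rewrite -ed.
  exists (r c); split; first by rewrite bar_r.
  by have := splits_r S; rewrite ed rK.
have top2c c (t : nat) : bar c = sigma t -> top2 c = top2 (alpha t).
  by case/ca=> ->; rewrite ?top2_r.
have le2 (t : nat) : t < T -> top2 (alpha t) <= top2 (alpha t.+1).
  move=> tT; have [c [bc [s [A [B [u S]]]]]] := spl t tT.
  by rewrite -top2ab // -(top2c c) //; apply: split_top2_le S.
have e2 (t : nat) : t < T -> top2 (alpha t.+1) = top2 (alpha t).
  move=> tT; apply/val_inj.
  have := closed_mono (f := fun t : nat => n - top2 (alpha t)) _ _ tT.
  rewrite aT => /(_ _ erefl) h; have := ltn_ord (top2 (alpha t)).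
  have := ltn_ord (top2 (alpha t.+1)).
  have : n - top2 (alpha t.+1) = n - top2 (alpha t).
    by apply: h => u uT; have := le2 u uT; lia.
  by rewrite /=; lia.
have {}spl (t : nat) : t < T -> exists s A B u, splits (alpha t.+1) (beta t) s A B u.
  move=> tT; have [c [bc S]] := spl t tT; suff <- : c = alpha t.+1 by [].
  have [x /paired_at_class[_ asb _]] := pr t tT.
  apply: ca' => //; case: S => s [A [B [u S]]].
  by apply: (split_asc S) asb; rewrite (top2c _ _ bc) e2 // top2ab.
have fr (t : nat) x : t <= T -> free (alpha t) x = free (alpha 0) x.
  elim: t => // t IH tT; apply: etrans (IH (ltnW tT)).
  by apply: free_eq; [apply: eL | apply: e2].
have nomove m : m <= n.+1 -> forall t : nat, t < T -> forall y : 'I_n.+1, y < m ->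
    ~~ movable (alpha t) y.
  elim: m => // m IH mn t0 t0T x xm; have {}IH := IH (ltnW mn).
  have [|mx] := ltnP x m; first exact: IH.
  have {xm mx} xm : x = m :> nat by lia.
  apply/negP=> mv; have fx (t : nat) : t <= T -> free (alpha t) x.
    by move=> tT; rewrite fr // -(fr t0) ?(ltnW t0T) //; case/andP: mv.
  have key (t : nat) : t < T -> single (alpha t) x /\
      (single (beta t) x \/
       exists s I u, splits (alpha t) (beta t) s [set x] I u).
    move=> tT; have [y pab] := pr t tT; have [s [I [u S]]] := paired_at_splits pab.
    have [may mby na nb] := paired_at_movable pab.
    have my : m <= y by rewrite leqNgt; apply/negP=> ym; have := IH t tT y ym; rewrite may.
    have [xy|/eqP xy] := eqVneq y x.
      by rewrite xy in S; split; [apply: splits_single S | right; exists s, I, u].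
    have {}xy : x < y.
      by rewrite ltn_neqAle xm my andbT; apply/eqP=> e; apply/xy/val_inj; rewrite /= xm.
    have fb : free (beta t) x.
      by rewrite (@free_eq _ (alpha t)) ?pL ?top2ab // fx // ltnW.
    have /andP[sa _] := nmovable_single (fx _ (ltnW tT)) (na _ xy).
    by have /andP[sb _] := nmovable_single fb (nb _ xy); split=> //; left.
  have sing (t : nat) : t <= T -> single (alpha t) x.
    rewrite leq_eqVlt => /orP[/eqP->|/key[]//].
    by rewrite aT; case: (key 0 T0).
  have lt (t : nat) s I u : t < T -> splits (alpha t) (beta t) s [set x] I u ->
      #|right_of (alpha t.+1) x| < #|right_of (alpha t) x|.
    move=> tT S; have [s' [A [B [u' S']]]] := spl t tT.
    by apply/proper_card/(right_of_swap S S'); [apply: sing | apply: neq].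
  have mono (t : nat) : t < T -> #|right_of (alpha t.+1) x| <= #|right_of (alpha t) x|.
    move=> tT; have [_ [sb|[s [I [u S]]]]] := key t tT; last exact: ltnW (lt _ _ _ _ tT S).
    have [s' [A [B [u' S']]]] := spl t tT; have [y /paired_at_splits[s [I [u S]]]] := pr t tT.
    by rewrite (right_of_split S sb) (right_of_split S' sb).
  have [y pab] := pr t0 t0T; have [may mby na nb] := paired_at_movable pab.
  have xy : y = x.
    apply/val_inj; case: (ltngtP y x) => // [yx|/na]; last by rewrite mv.
    by have := IH t0 t0T y; rewrite -xm yx may => /(_ isT).
  have [s [I [u S]]] := paired_at_splits pab; rewrite xy in S.
  have := lt _ _ _ _ t0T S.
  rewrite (closed_mono (f := fun t : nat => #|right_of (alpha t) x|) mono _ t0T) ?aT //.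
  by rewrite ltnn.
have [x /paired_at_movable[mv _ _ _]] := pr 0 T0.
by have := nomove _ (leqnn _) 0 T0 x (ltn_ord x); rewrite mv.
Qed.

End Proof.

Theorem theorem5p9 (n : nat) (hn : 2 <= n) :
  discrete_morse_function (@QP_dim n) (@QP_incl n) (@V n).
Proof. by split; [apply: V_vector_field | move=> p t s u; apply: V_acyclic]. Qed.
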